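(* Let $f:\mathbb{R}^n\to\mathbb{R}$ be a continuously differentiable function that is $L$-smooth and $\mu$-strongly convex, with $L>0$ and $0\le\mu\le L$ (the case $\mu=0$ meaning that $f$ is just convex), and let $\mathbf{x}^*$ be a minimizer of $f$ over $\mathbb{R}^n$. Let $\mu_0=L-\mu$ and let $k\ge 0$ be an integer. Let the positive scalars $\{a_i\}_{i=0}^k$, with $A_i=\sum_{j=0}^i a_j$, satisfy $a_0=1$ and $$\frac{a_i^2}{A_i(\mu_0+\mu A_i)}=\frac1L \qquad\text{for all } i\in\{0,\dots,k\},$$ and set $a_i'=\frac{a_i(\mu_0+\mu A_{i-1})}{\mu_0+\mu A_i}$ for $i\in\{1,\dots,k\}$. Let $\{\mathbf{x}_i\}_{i=0}^k$ and $\{\mathbf{y}_i\}_{i=0}^k$ be sequences of points in $\mathbb{R}^n$ and, for $i\in\{0,\dots,k\}$, let $$\mathbf{v}_i=\operatorname*{argmin}_{\mathbf{u}\in\mathbb{R}^n}\Big\{\sum_{j=0}^i a_j\Big(\langle\nabla f(\mathbf{x}_j),\mathbf{u}-\mathbf{x}_j\rangle+\frac{\mu}{2}\|\mathbf{u}-\mathbf{x}_j\|^2\Big)+\frac{\mu_0}{2}\|\mathbf{u}-\mathbf{x}_0\|^2\Big\}.$$ Suppose that $f(\mathbf{y}_i)\le f(\mathbf{x}_i)-\frac{1}{2L}\|\nabla f(\mathbf{x}_i)\|^2$ for all $i\in\{0,\dots,k\}$, and that for all $i\in\{1,\dots,k\}$ $$\big\langle\nabla f(\mathbf{x}_i),\,(A_{i-1}+a_i')\mathbf{x}_i-A_{i-1}\mathbf{y}_{i-1}-a_i'\mathbf{v}_{i-1}\big\rangle=0.$$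 Then $$f(\mathbf{y}_k)-f(\mathbf{x}^* )\le\min\Big\{\frac{4}{(k+1)(k+2)},\Big(1-\sqrt{\tfrac{\mu}{L}}\Big)^k\Big\}\frac{(L-\mu)\|\mathbf{x}^*-\mathbf{x}_0\|^2}{2}.$$
   Context: $\|\cdot\|$ is the standard Euclidean norm on $\mathbb{R}^n$ and $\langle\cdot,\cdot\rangle$ the standard inner product. A continuously differentiable $f:\mathbb{R}^n\to\mathbb{R}$ is $L$-smooth if $f(\mathbf{y})\le f(\mathbf{x})+\langle\nabla f(\mathbf{x}),\mathbf{y}-\mathbf{x}\rangle+\frac L2\|\mathbf{y}-\mathbf{x}\|^2$ for all $\mathbf{x},\mathbf{y}\in\mathbb{R}^n$, and $\mu$-strongly convex if $f(\mathbf{y})\ge f(\mathbf{x})+\langle\nabla f(\mathbf{x}),\mathbf{y}-\mathbf{x}\rangle+\frac\mu2\|\mathbf{y}-\mathbf{x}\|^2$ for all $\mathbf{x},\mathbf{y}\in\mathbb{R}^n$ ($\mu=0$ is ordinary convexity). *)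

(* Defs.v *)
From HB Require Import structures.
From mathcomp Require Import all_boot all_order all_algebra.
From mathcomp Require Import all_classical all_reals all_analysis.

Set Implicit Arguments.
Unset Strict Implicit.
Unset Printing Implicit Defensive.

Import Order.TTheory GRing.Theory Num.Theory.
Import numFieldNormedType.Exports.

Local Open Scope classical_set_scope.
Local Open Scope ring_scope.

Section euclidean.
Context {R : realType} {n : nat}.
Implicit Types (u v x y : 'rV[R]_n) (f : 'rV[R]_n -> R).

Definition dotv u v : R := \sum_(j < n) u 0 j * v 0 j.

(* The library norm [`|u|] on ['rV[R]_n] is the sup norm; it is only used
   below through the topology it induces. *)
Definition enorm u : R := Num.sqrt (dotv u u).

Definition grad f x : 'rV[R]_n := \row_(j < n) 'D_(delta_mx 0 j) f x.

Definition continuously_differentiable f :=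
  (forall x, differentiable f x) /\ continuous (grad f).

Definition smooth (L : R) f := forall x y,
  f y <= f x + dotv (grad f x) (y - x) + L / 2 * enorm (y - x) ^+ 2.

Definition strongly_convex (mu : R) f := forall x y,
  f y >= f x + dotv (grad f x) (y - x) + mu / 2 * enorm (y - x) ^+ 2.

Definition argmin f : set 'rV[R]_n := [set u | forall w, f u <= f w].

End euclidean.

(* Main.v *)
Require Import Defs.
From HB Require Import structures.
From mathcomp Require Import all_boot all_order all_algebra.
From mathcomp Require Import all_classical all_reals all_analysis.
From mathcomp Require Import ring lra.

(** Estimate sequences: the strongly convex lower models of [f] at the [x j],
weighted by [a j], add up with [mu0 / 2 * |u - x 0|^2] to a quadratic [psi i]
of curvature [mu0 + mu * A i] minimized at [v i]. By strong convexity,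
[psi k xstar <= A k * f xstar + mu0 / 2 * |xstar - x 0|^2], while
[A i * f (y i) <= psi i] everywhere by induction: the linear terms cancel by
the orthogonality condition, and completing the square costs
[a i ^+ 2 / (2 * (mu0 + mu * A i)) * |grad f (x i)|^2], which the choice of
[a i] makes exactly [A i] times the guaranteed descent. The gap is thus at most
[mu0 / 2 * |xstar - x 0|^2 / A k], and [A] grows at both claimed rates since
[a i ^+ 2 >= A i] and [a i ^+ 2 >= mu / L * A i ^+ 2]. *)

Set Implicit Arguments.
Unset Strict Implicit.
Unset Printing Implicit Defensive.

Import Order.TTheory GRing.Theory Num.Theory.
Import numFieldNormedType.Exports.

Local Open Scope classical_set_scope.
Local Open Scope ring_scope.

(** * Inner product algebra and quadratics with scalar Hessian *)

Section euclidean_space.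
Context {R : realType} {n : nat}.
Implicit Types (u v x d g : 'rV[R]_n) (F G : 'rV[R]_n -> R) (c m : R).

Lemma dotvC u v : dotv u v = dotv v u.
Proof. by apply: eq_bigr => j _; rewrite mulrC. Qed.

Lemma dotvDl u v x : dotv (u + v) x = dotv u x + dotv v x.
Proof. by rewrite -big_split; apply: eq_bigr => j _; rewrite mxE mulrDl. Qed.

Lemma dotvZl c u v : dotv (c *: u) v = c * dotv u v.
Proof. by rewrite mulr_sumr; apply: eq_bigr => j _; rewrite mxE mulrA. Qed.

Lemma dotvNl u v : dotv (- u) v = - dotv u v.
Proof. by rewrite -scaleN1r dotvZl mulN1r. Qed.

Lemma dotvDr u v x : dotv x (u + v) = dotv x u + dotv x v.
Proof. by rewrite dotvC dotvDl !(dotvC x). Qed.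

Lemma dotvZr c u v : dotv u (c *: v) = c * dotv u v.
Proof. by rewrite dotvC dotvZl dotvC. Qed.

Lemma dotvNr u v : dotv u (- v) = - dotv u v.
Proof. by rewrite dotvC dotvNl dotvC. Qed.

Lemma dotv0r u : dotv u 0 = 0.
Proof. by rewrite -(scale0r u) dotvZr mul0r. Qed.

Definition dotvE := (dotvDl, dotvDr, dotvNl, dotvNr, dotvZl, dotvZr).

Lemma dotv_ge0 u : 0 <= dotv u u.
Proof. by apply: sumr_ge0 => j _; rewrite -expr2 sqr_ge0. Qed.

Lemma enorm_sqr u : enorm u ^+ 2 = dotv u u.
Proof. by rewrite sqr_sqrtr ?dotv_ge0. Qed.

(* Quadratic functions of Hessian [m%:M], described along chords so that sums
   need no explicit formula for the minimizer. *)
Definition curvature m F := forall u v t,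
  F (v + t *: (u - v)) =
    (1 - t) * F v + t * F u - m / 2 * (t * (1 - t)) * enorm (u - v) ^+ 2.

Lemma curvatureD m1 m2 F G : curvature m1 F -> curvature m2 G ->
  curvature (m1 + m2) (fun u => F u + G u).
Proof. by move=> hF hG u v t; rewrite hF hG; field. Qed.

Lemma curvatureZ c m F : curvature m F -> curvature (c * m) (fun u => c * F u).
Proof. by move=> hF u v t; rewrite hF; field. Qed.

Lemma curvature_sum (N : nat) (m : nat -> R) (F : nat -> 'rV[R]_n -> R) :
  (forall j, curvature (m j) (F j)) ->
  curvature (\sum_(0 <= j < N) m j) (fun u => \sum_(0 <= j < N) F j u).
Proof.
move=> hF u v t; elim: N => [|N IH]; first by rewrite !big_geq//; ring.
by rewrite !big_nat_recr//= IH hF; field.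
Qed.

Lemma curvature_model m g x :
  curvature m (fun u => dotv g (u - x) + m / 2 * enorm (u - x) ^+ 2).
Proof.
move=> u v t; rewrite !enorm_sqr.
have -> : v + t *: (u - v) - x = (v - x) + t *: (u - v) by rewrite addrAC.
have -> : u - x = (v - x) + (u - v) by rewrite [RHS]addrC addrA subrK.
move: (v - x) (u - v) => p d.
by rewrite !dotvE (dotvC d p); field.
Qed.

Lemma curvature_sqr m x : curvature m (fun u => m / 2 * enorm (u - x) ^+ 2).
Proof.
move=> u v t; have := curvature_model m 0 x u v t.
by rewrite !(dotvC 0) !dotv0r !add0r.
Qed.

(** Comparing [v] with [v + t *: (u - v)] and dividing by [t] leaves the claim with the quadratic
    term scaled by [1 - t]; then [t] tends to 0. *)
Lemma argmin_growth m F v u : 0 <= m -> curvature m F -> argmin F v ->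
  F v + m / 2 * enorm (u - v) ^+ 2 <= F u.
Proof.
move=> m0 hF vmin.
have q0 : 0 <= m / 2 * enorm (u - v) ^+ 2.
  by rewrite mulr_ge0 ?sqr_ge0// divr_ge0.
apply/ler_addgt0Pl => e e0.
set q := m / 2 * enorm (u - v) ^+ 2 in q0 *.
(* This [t] is positive even when [q = 0], and it keeps the error [t * q] below [e]. *)
pose t := e / (e + q).
have eq0 : 0 < e + q by rewrite ltr_pwDl.
have t0 : 0 < t by rewrite divr_gt0.
have tq : t * q <= e by rewrite mulrAC ler_pdivrMr// ler_pM2l// lerDr ltW.
have := vmin (v + t *: (u - v)); rewrite hF => h.
have : 0 <= t * (F u - F v - (1 - t) * q) by rewrite /q; lra.
by rewrite pmulr_rge0//; lra.
Qed.

(** With [p = u - x] and [q = v - x], the gap between the two sides is a square, vanishing at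
    [M *: p = m *: q - a *: g], plus a nonnegative multiple of [dotv q q]. The factor of
    [dotv g (v - x)] is the [a'] of the theorem. *)
Lemma complete_square (m a mu : R) g u v x : 0 <= m -> 0 <= a -> 0 <= mu ->
  0 < m + mu * a ->
  a * m / (m + mu * a) * dotv g (v - x)
    - a ^+ 2 / (2 * (m + mu * a)) * enorm g ^+ 2
  <= m / 2 * enorm (u - v) ^+ 2
     + a * (dotv g (u - x) + mu / 2 * enorm (u - x) ^+ 2).
Proof.
move=> m0 a0 mu0 M0; rewrite !enorm_sqr.
have -> : u - v = (u - x) - (v - x) by rewrite opprB addrA subrK.
move: (u - x) (v - x) => p q.
rewrite -subr_ge0; set M := m + mu * a in M0 *.
rewrite [leRHS](_ : _ = (2 * M)^-1 *
    (dotv (M *: p - m *: q + a *: g) (M *: p - m *: q + a *: g)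
     + m * (mu * a) * dotv q q)); first last.
  rewrite !dotvE (dotvC q p) (dotvC p g) (dotvC q g) /M; field.
  by rewrite -/M gt_eqF.
by rewrite mulr_ge0 ?invr_ge0 ?addr_ge0 ?mulr_ge0 ?dotv_ge0// ltW.
Qed.

End euclidean_space.

(** * Growth of the weights, with [q] standing for [mu / L] *)

Section growth.
Context {R : rcfType}.
Variables (k : nat) (a A : nat -> R) (q : R).
Hypotheses (a_gt0 : forall i, (i <= k)%N -> 0 < a i) (A0 : A 0%N = 1).
Hypothesis AS : forall i, (i < k)%N -> A i.+1 = A i + a i.+1.
Hypothesis a_sqr : forall i, (i <= k)%N -> a i ^+ 2 = A i * (1 - q + q * A i).
Hypotheses (q_ge0 : 0 <= q) (q_le1 : q <= 1).

Lemma weight_ge1 i : (i <= k)%N -> 1 <= A i.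
Proof.
elim: i => [|i IH] ik; first by rewrite A0.
by rewrite AS//; have := IH (ltnW ik); have := a_gt0 ik; lra.
Qed.

(** The square root of [A] gains at least 1/2 per step: [a i.+1 ^+ 2 >= A i + a i.+1] gives
    [(a i.+1 - 1 / 2) ^+ 2 >= A i]. *)
Lemma weight_quadratic i : (i <= k)%N -> i.+2%:R ^+ 2 / 4 <= A i.
Proof.
elim: i => [|i IH] ik; first by rewrite A0; lra.
have h1 := weight_ge1 ik; have a0 := a_gt0 ik.
have A_le : A i.+1 <= a i.+1 ^+ 2 by rewrite a_sqr// ler_peMr//; have := ler_peMr q_ge0 h1; lra.
have {IH} := IH (ltnW ik); rewrite -[i.+3]addn1 natrD.
have : 0 <= i.+2%:R :> R by rewrite ler0n.
move: (i.+2%:R) => s s0 IH.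
have a1 : 1 <= a i.+1 by nra.
have as_ : s / 2 <= a i.+1 - 1 / 2.
  rewrite -ler_sqr ?nnegrE; [|lra|lra].
  by move: A_le; rewrite AS//; nra.
by rewrite AS//; nra.
Qed.

(** From [a i.+1 >= Num.sqrt q * A i.+1] follows [A i <= (1 - Num.sqrt q) * A i.+1]. The product
    form avoids dividing by [1 - Num.sqrt q], which is 0 at [q = 1]. *)
Lemma weight_geometric i : (i <= k)%N -> 1 <= (1 - Num.sqrt q) ^+ i * A i.
Proof.
have s1 : Num.sqrt q <= 1 by rewrite -sqrtr1 ler_sqrt.
elim: i => [|i IH] ik; first by rewrite A0 expr0 mulr1.
apply: le_trans (IH (ltnW ik)) _.
rewrite exprSr -mulrA ler_wpM2l ?exprn_ge0 ?subr_ge0//.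
have A1 := weight_ge1 ik.
suff : Num.sqrt q * A i.+1 <= a i.+1 by have := AS ik; lra.
rewrite -ler_sqr ?nnegrE ?mulr_ge0 ?sqrtr_ge0//; [|lra|exact/ltW/a_gt0].
have : 0 <= A i.+1 * (1 - q) by apply: mulr_ge0; [lra|rewrite subr_ge0].
by rewrite exprMn sqr_sqrtr// a_sqr//; lra.
Qed.

Lemma inv_weight_le : (A k)^-1 <=
  Num.min (4 / (k.+1%:R * k.+2%:R)) ((1 - Num.sqrt q) ^+ k).
Proof.
have Ak : 0 < A k by apply: lt_le_trans (weight_ge1 (leqnn k)).
rewrite le_min; apply/andP; split.
  rewrite -[4 / _]invf_div lef_pV2 ?posrE ?divr_gt0 ?mulr_gt0//.
  apply: le_trans (weight_quadratic (leqnn k)).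
  by rewrite ler_pM2r// expr2 ler_wpM2r// ler_nat.
by rewrite -[leLHS]mul1r ler_pdivrMr//; apply: weight_geometric.
Qed.

End growth.

(** * The estimate sequence and the final rate *)

Theorem theorem2p3 (R : realType) (n : nat) (f : 'rV[R]_n -> R) (L mu : R)
  (f_C1 : continuously_differentiable f)
  (L_gt0 : 0 < L) (mu_ge0 : 0 <= mu) (mu_leL : mu <= L)
  (f_smooth : smooth L f) (f_sconvex : strongly_convex mu f)
  (xstar : 'rV[R]_n) (xstar_min : argmin f xstar)
  (mu0 : R) (mu0E : mu0 = L - mu)
  (k : nat) (a A a' : nat -> R)
  (a_gt0 : forall i, (i <= k)%N -> 0 < a i)
  (AE : forall i, (i <= k)%N -> A i = \sum_(0 <= j < i.+1) a j)
  (a0E : a 0%N = 1)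
  (aAE : forall i, (i <= k)%N -> a i ^+ 2 / (A i * (mu0 + mu * A i)) = 1 / L)
  (a'E : forall i, (1 <= i <= k)%N ->
     a' i = a i * (mu0 + mu * A i.-1) / (mu0 + mu * A i))
  (x y v : nat -> 'rV[R]_n)
  (v_argmin : forall i, (i <= k)%N ->
     argmin (fun u : 'rV[R]_n =>
       \sum_(0 <= j < i.+1)
          a j * (dotv (grad f (x j)) (u - x j)
                 + mu / 2 * enorm (u - x j) ^+ 2)
       + mu0 / 2 * enorm (u - x 0%N) ^+ 2) (v i))
  (y_descent : forall i, (i <= k)%N ->
     f (y i) <= f (x i) - 1 / (2 * L) * enorm (grad f (x i)) ^+ 2)
  (orth : forall i, (1 <= i <= k)%N ->
     dotv (grad f (x i))
       ((A i.-1 + a' i) *: x i - A i.-1 *: y i.-1 - a' i *: v i.-1) = 0) :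
  f (y k) - f xstar <=
    Num.min (4 / (k.+1%:R * k.+2%:R)) ((1 - Num.sqrt (mu / L)) ^+ k)
    * ((L - mu) * enorm (xstar - x 0%N) ^+ 2 / 2).
Proof.
have mu0_ge0 : 0 <= mu0 by rewrite mu0E subr_ge0.
have AS i : (i < k)%N -> A i.+1 = A i + a i.+1.
  by move=> ik; rewrite !AE ?(ltnW ik)// big_nat_recr.
have A0 : A 0%N = 1 by rewrite AE// big_nat1.
have A_gt0 i : (i <= k)%N -> 0 < A i.
  by move=> ik; apply: lt_le_trans (weight_ge1 a_gt0 A0 AS ik).
pose M i := mu0 + mu * A i.
have M_gt0 i : (i <= k)%N -> 0 < M i.
  (* As [A i >= 1], [M i] is at least [mu0 + mu = L], which covers both [mu = 0] and [mu = L]. *)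
  move=> ik; have := weight_ge1 a_gt0 A0 AS ik.
  by rewrite /M mu0E; nra.
have a_sqr i : (i <= k)%N -> L * a i ^+ 2 = A i * M i.
  move=> ik; have := aAE _ ik.
  have := A_gt0 _ ik; have := M_gt0 _ ik; rewrite -/(M i) => m0 p0.
  move/eqP; rewrite eqr_div ?mulf_neq0 ?lt0r_neq0// mul1r => /eqP.
  by rewrite mulrC.
pose model j (u : 'rV[R]_n) :=
  dotv (grad f (x j)) (u - x j) + mu / 2 * enorm (u - x j) ^+ 2.
(* [psi i] is split as [S i + Phi i] because [v i] is defined by [Phi i] alone. *)
pose Phi i u :=
  \sum_(0 <= j < i.+1) a j * model j u + mu0 / 2 * enorm (u - x 0%N) ^+ 2.
pose S i := \sum_(0 <= j < i.+1) a j * f (x j).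
have Phi_curv i : (i <= k)%N -> curvature (M i) (Phi i).
  move=> ik; rewrite /M AE// addrC; apply: curvatureD; last exact: curvature_sqr.
  rewrite mulr_sumr; apply: curvature_sum => j; rewrite mulrC.
  exact/curvatureZ/curvature_model.
have lower i : (i <= k)%N -> forall u, A i * f (y i) <= S i + Phi i u.
  elim: i => [|i IH] ik u.
    (* Base case: with [m = mu0], [a = 1] and [v = x], the loss is exactly the descent guaranteed at
       [y 0]. *)
    have := complete_square (grad f (x 0%N)) u (x 0%N) (x 0%N)
      mu0_ge0 ler01 mu_ge0.
    have -> : mu0 + mu * 1 = L by rewrite mu0E; ring.
    move=> /(_ L_gt0).
    have := y_descent _ ik.
    rewrite /S /Phi !big_nat1 a0E A0 /model subrr.
    by rewrite dotv0r expr1n; lra.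
  have iltk := ltnW ik.
  have := orth i.+1 ik; rewrite /= a'E// -/(M i) -/(M i.+1).
  (* [b] is [a' i.+1], so orthogonality trades the term at [v i] for minus the term at [y i]. *)
  set b := a i.+1 * M i / M i.+1.
  have -> : (A i + b) *: x i.+1 - A i *: y i - b *: v i
      = - (A i *: (y i - x i.+1) + b *: (v i - x i.+1)).
    by apply/rowP => j; rewrite !mxE; ring.
  rewrite dotvNr dotvDr !dotvZr => hb.
  (* The induction hypothesis is needed only at [v i]; quadratic growth of [Phi i] carries it to
     [u]. *)
  have := IH iltk (v i).
  have := argmin_growth u (ltW (M_gt0 _ iltk)) (Phi_curv _ iltk) (v_argmin _ iltk).
  have MS : M i + mu * a i.+1 = M i.+1 by rewrite /M AS//; ring.
  have := complete_square (grad f (x i.+1)) u (v i) (x i.+1)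
    (ltW (M_gt0 _ iltk)) (ltW (a_gt0 _ ik)) mu_ge0.
  rewrite MS -/b => /(_ (M_gt0 _ ik)).
  have -> : a i.+1 ^+ 2 / (2 * M i.+1) = A i.+1 / (2 * L).
    apply/eqP; rewrite eqr_div ?mulf_neq0 ?lt0r_neq0 ?M_gt0//; apply/eqP.
    by have := a_sqr _ ik; lra.
  have := f_sconvex (x i.+1) (y i).
  have : 0 <= mu / 2 * enorm (y i - x i.+1) ^+ 2.
    by rewrite mulr_ge0 ?sqr_ge0// divr_ge0.
  have := y_descent _ ik.
  have -> : S i.+1 = S i + a i.+1 * f (x i.+1) by rewrite /S big_nat_recr.
  have -> : Phi i.+1 u = Phi i u + a i.+1 * model i.+1 u.
    by rewrite /Phi big_nat_recr//= addrAC.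
  move=> hy hq hf hsq hg hI.
  have hy' := ler_wpM2l (ltW (A_gt0 _ ik)) hy.
  have hf' : A i * (f (x i.+1) + dotv (grad f (x i.+1)) (y i - x i.+1)) <=
      A i * f (y i) by apply: ler_wpM2l; [exact/ltW/A_gt0|lra].
  rewrite mulrBr in hy'.
  have hA : A i.+1 * f (x i.+1) = A i * f (x i.+1) + a i.+1 * f (x i.+1).
    by rewrite AS// mulrDl.
  move: hsq hy' hf' hb.
  set G := enorm (grad f _) ^+ 2.
  have -> : A i.+1 * (1 / (2 * L) * G) = A i.+1 / (2 * L) * G by ring.
  by rewrite -/(model i.+1 u); lra.
have upper : S k + Phi k xstar <= A k * f xstar + mu0 / 2 * enorm (xstar - x 0%N) ^+ 2.
  rewrite /Phi addrA lerD2r /S -big_split /= AE// mulr_suml.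
  (* Keeps the bound on [j] at hand, since [a j] is known positive only up to [k]. *)
  rewrite big_nat_cond [leRHS]big_nat_cond.
  apply: ler_sum => j /andP[/andP[_ jk] _].
  rewrite -mulrDr ler_wpM2l ?(ltW (a_gt0 _ _))// /model addrA.
  exact: f_sconvex.
have Ak := A_gt0 _ (leqnn k).
have gap : f (y k) - f xstar <= (A k)^-1 * ((L - mu) * enorm (xstar - x 0%N) ^+ 2 / 2).
  rewrite ler_pdivlMl// mulrBr -mu0E.
  by have := le_trans (lower _ (leqnn k) xstar) upper; lra.
apply: le_trans gap _; apply: ler_wpM2r.
  by rewrite divr_ge0// mulr_ge0 ?sqr_ge0// subr_ge0.
apply: inv_weight_le a_gt0 A0 AS _ _ _.
- move=> i ik; apply: (mulfI (lt0r_neq0 L_gt0)); rewrite a_sqr// /M mu0E.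
  by field; rewrite gt_eqF.
- by rewrite divr_ge0// ltW.
- by rewrite ler_pdivrMr// mul1r.
Qed.
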